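(* A bipartite graph is Parikh word representable if and only if every one of its connected components is Parikh word representable.
   Context: Let $\Sigma=\{a_1<a_2<\dots<a_s\}$ be a finite ordered alphabet and $w=w_1w_2\cdots w_n$ a nonempty word over $\Sigma$ with each $w_i\in\Sigma$. The Parikh graph $\mathcal{G}(w)$ of $w$ over $\Sigma$ is the simple undirected graph with vertex set $\{1,\dots,n\}$ in which, for $1\le i<j\le n$, the vertices $i$ and $j$ are adjacent if and only if $w_i=a_k$ and $w_j=a_{k+1}$ for some $1\le k\le s-1$. A (finite) graph $G$ is Parikh word representable if $G$ is isomorphic to $\mathcal{G}(w)$ for some nonempty word $w$ over some finite ordered alphabet. *)

(* Defs.v *)
From mathcomp Require Import all_boot.
Set Implicit Arguments.
Unset Strict Implicit.
Unset Printing Implicit Defensive.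

Record sgraph := SGraph {
  vertex :> finType;
  adj : rel vertex;
  adj_sym : symmetric adj;
  adj_irrefl : irreflexive adj
}.

Definition isomorphic (G H : sgraph) : Prop :=
  exists2 f : G -> H, bijective f & forall x y, adj (f x) (f y) = adj x y.

Definition bipartite (G : sgraph) : Prop :=
  exists A : {set G}, forall x y : G, adj x y -> (x \in A) != (y \in A).

Section Induced.
Variables (G : sgraph) (C : {set G}).

Definition induced_adj : rel {x : G | x \in C} :=
  fun x y => adj (val x) (val y).

Lemma induced_adj_sym : symmetric induced_adj.
Proof. by move=> x y; apply: adj_sym. Qed.

Lemma induced_adj_irrefl : irreflexive induced_adj.
Proof. by move=> x; apply: adj_irrefl. Qed.

Definition induced : sgraph := SGraph induced_adj_sym induced_adj_irrefl.
End Induced.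

Definition components (G : sgraph) : {set {set G}} :=
  [set [set y | connect (@adj G) x y] | x : G].

Section ParikhGraph.
(* The ordered alphabet a_1 < ... < a_s is 'I_s, with a_k encoded as k - 1;
   positions 1, ..., n of a word are likewise shifted to 0, ..., n - 1. *)
Variables (s n : nat) (w : n.-tuple 'I_s).

Definition parikh_arc : rel 'I_n :=
  fun i j => (i < j) && (val (tnth w j) == (val (tnth w i)).+1).

Definition parikh_adj : rel 'I_n :=
  fun i j => parikh_arc i j || parikh_arc j i.

Lemma parikh_adj_sym : symmetric parikh_adj.
Proof. by move=> i j; apply: orbC. Qed.

Lemma parikh_adj_irrefl : irreflexive parikh_adj.
Proof. by move=> i; rewrite /parikh_adj /parikh_arc ltnn. Qed.

Definition parikh_graph : sgraph := SGraph parikh_adj_sym parikh_adj_irrefl.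
End ParikhGraph.

Definition parikh_word_representable (G : sgraph) : Prop :=
  exists (s n : nat) (w : n.-tuple 'I_s),
    0 < n /\ isomorphic G (parikh_graph w).

(* Main.v *)
(** Up to isomorphism, a Parikh graph is given by a letter and a position for
    each vertex.  Restricting these data to a component represents the
    component.  Conversely, data for the components are glued by shifting the
    letters of distinct components into blocks separated by an unused letter,
    so that no two components contain consecutive letters. *)
Require Import Defs.
From mathcomp Require Import all_boot.
From mathcomp Require Import zify.

Set Implicit Arguments.
Unset Strict Implicit.
Unset Printing Implicit Defensive.

Definition arc_of (T : Type) (l p : T -> nat) : rel T :=
  fun x y => (p x < p y) && (l y == (l x).+1).

(* [p] need not be injective: equal positions are ordered by decreasing
   letters, which creates no new arc. *)
Definition position_le (T : Type) (l p : T -> nat) : rel T :=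
  fun x y => (p x < p y) || (p x == p y) && (l y <= l x).

Lemma position_le_total (T : Type) (l p : T -> nat) : total (position_le l p).
Proof. by move=> x y; rewrite /position_le; lia. Qed.

Lemma position_le_trans (T : Type) (l p : T -> nat) :
  transitive (position_le l p).
Proof. by move=> y x z; rewrite /position_le; lia. Qed.

(** Arcs depend on positions only through their order, so sorting the vertices by [position_le] and
    reading off their letters gives the word. *)
Lemma representableP (G : sgraph) :
  parikh_word_representable G <->
  0 < #|G| /\ exists l p : G -> nat,
    forall x y, adj x y = arc_of l p x y || arc_of l p y x.
Proof.
split=> [[s [n [w [n_gt0 [f [g fK gK] adj_f]]]]]|[G_gt0 [l [p adjE]]]].
  split; first by apply/card_gt0P; exists (g (Ordinal n_gt0)).
  by exists (fun x => val (tnth w (f x))), (fun x => val (f x)) => x y;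
     rewrite -adj_f.
pose s := (\max_x l x).+1.
have l_lt x : l x < s by rewrite ltnS leq_bigmax.
pose e := sort (position_le l p) (enum G).
have e_size : size e == #|G| by rewrite size_sort cardE.
have in_e x : x \in e by rewrite mem_sort mem_enum.
have e_sorted : sorted (position_le l p) e.
  exact: sort_sorted (position_le_total l p) _.
pose w := map_tuple (fun x => Ordinal (l_lt x)) (Tuple e_size).
have idx_lt x : index x e < #|G| by rewrite -(eqP e_size) index_mem.
pose f x := Ordinal (idx_lt x).
have tnth_f x : tnth (Tuple e_size) (f x) = x.
  by rewrite (tnth_nth x) /= nth_index.
have f_inj : injective f by apply: can_inj tnth_f.
exists s, #|G|, w; split=> //; exists f.
  by apply: inj_card_bij => //; rewrite card_ord.
have arcE x y : parikh_arc w (f x) (f y) = arc_of l p x y.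
  rewrite /parikh_arc /arc_of !tnth_map !tnth_f /=.
  case: eqP => [lE|]; rewrite ?andbF // !andbT.
  have le_idx a b : index a e < index b e -> position_le l p a b.
    by apply: sorted_ltn_index => //; apply: position_le_trans.
  (* Here [l y = (l x).+1], so a tie in [p] puts [y] before [x]; hence [x] precedes [y] in [e]
     exactly when [p x < p y]. *)
  case: (ltngtP (index x e) (index y e)) => [/le_idx|/le_idx|idxE].
  - by rewrite /position_le; lia.
  - by rewrite /position_le; lia.
  - have xy : x = y by apply: f_inj; apply: val_inj.
    by rewrite xy ltnn.
by move=> x y; rewrite adjE /= /parikh_adj !arcE.
Qed.

(** Labelling all of [G] gives the data of every component the same type, so they can be chosen
    together. *)
Lemma representable_inducedP (G : sgraph) (C : {set G}) :
  parikh_word_representable (induced C) <->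
  0 < #|C| /\ exists l p : G -> nat,
    {in C &, forall x y, adj x y = arc_of l p x y || arc_of l p y x}.
Proof.
have cardC : #|induced C| = #|C| by rewrite card_sig.
rewrite representableP cardC; split=> -[C_gt0 [l [p adjE]]]; split=> //.
  (* The default 0 outside [C] is never tested. *)
  pose lift (h : induced C -> nat) (x : G) := oapp h 0 (insub x).
  have liftE h x (Cx : x \in C) : lift h x = h (Sub x Cx).
    by rewrite /lift insubT.
  exists (lift l), (lift p) => x y Cx Cy.
  by have := adjE (Sub x Cx) (Sub y Cy); rewrite /arc_of !liftE.
exists (l \o val), (p \o val) => x y.
exact: adjE (valP x) (valP y).
Qed.

Theorem theorem3p10 (G : sgraph) (G_nonempty : 0 < #|G|) (G_bip : bipartite G) :
  parikh_word_representable G <->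
  (forall C : {set G}, C \in components G ->
     parikh_word_representable (induced C)).
Proof.
pose comp (x : G) := [set y | connect (@adj G) x y].
have comp_in x : comp x \in components G by apply: imset_f.
have mem_comp x : x \in comp x by rewrite inE connect0.
split=> [/representableP[_ [l [p adjE]]] C /imsetP[x _ ->] | repC].
  apply/representable_inducedP; split; first by apply/card_gt0P; exists x.
  by exists l, p => y z _ _; apply: adjE.
apply/representableP; split=> //.
have /fin_all_exists[l /fin_all_exists[p adjE]] (C : {set G}) :
    exists l p : G -> nat, C \in components G ->
      {in C &, forall x y, adj x y = arc_of l p x y || arc_of l p y x}.
  have [/repC/representable_inducedP[_ [l [p adjE]]]|_] :=
    boolP (C \in components G); first by exists l, p.
  by exists (fun=> 0), (fun=> 0).
pose M := (\max_(C : {set G}) \max_x l C x).+2.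
have l_lt C x : (l C x).+1 < M.
  by rewrite !ltnS (leq_trans _ (leq_bigmax C)) // leq_bigmax.
pose L x := enum_rank (comp x) * M + l (comp x) x.
(* Positions need no shift: they may interleave or coincide across components, since the letters
   already exclude arcs there. *)
pose P x := p (comp x) x.
have L_succ x y : L y = (L x).+1 -> comp x = comp y.
  (* Division by [M] recovers the block number, that is, the rank of the component. *)
  move=> /(congr1 (divn^~ M)); rewrite /L -addnS !divnMDl //.
  rewrite !divn_small ?l_lt ?(ltnW (l_lt _ _)) // !addn0.
  by move/val_inj/enum_rank_inj.
have adj_csym : connect_sym (@adj G).
  exact/sym_connect_sym/adj_sym.
have adj_comp x y : adj x y -> comp x = comp y.
  move=> /connect1 xy; apply/setP => z.
  by rewrite !inE (same_connect adj_csym xy).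
exists L, P => x y.
have [xy|xy] := eqVneq (comp x) (comp y).
  have Cx : x \in comp y by rewrite -xy.
  rewrite (adjE _ (comp_in y)) // /arc_of /L /P xy -!addnS.
  by rewrite !eqn_add2l.
(* Across distinct components both sides are false. *)
have -> : adj x y = false.
  by apply: contraNF xy => /adj_comp ->.
by symmetry; apply: contraNF xy => /orP[] /andP[_ /eqP/L_succ ->].
Qed.
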